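(* Let $\mathscr{F}\subseteq\mathscr{P}(\omega)$ be an $\omega$-closed family. Then $\boldsymbol{B}_{\mathbb{Z}}^{\mathscr{F}}$ is a combinatorial inverse semigroup.
   Context: $\omega$ is the set of non-negative integers and $\mathscr{P}(\omega)$ is the family of all its subsets. For $n\in\mathbb{Z}$ and $A\subseteq\mathbb{Z}$ put $n+A=\{n+a: a\in A\}$ (so $n+\varnothing=\varnothing$). A family $\mathscr{F}\subseteq\mathscr{P}(\omega)$ is $\omega$-closed if $F_1\cap(-n+F_2)\in\mathscr{F}$ for all $n\in\omega$ and $F_1,F_2\in\mathscr{F}$. For an $\omega$-closed family $\mathscr{F}$, the set $\mathbb{Z}\times\mathbb{Z}\times\mathscr{F}$ carries the associative operation $$(i_1,j_1,F_1)\cdot(i_2,j_2,F_2)=\begin{cases}(i_1-j_1+i_2,\;j_2,\;(j_1-i_2+F_1)\cap F_2), & j_1<i_2;\\ (i_1,\;j_2,\;F_1\cap F_2), & j_1=i_2;\\ (i_1,\;j_1-i_2+j_2,\;F_1\cap(i_2-j_1+F_2)), & j_1>i_2.\end{cases}$$ If $\varnothing\in\mathscr{F}$, then $\boldsymbol{I}=\{(i,j,\varnothing): i,j\in\mathbb{Z}\}$ is an ideal and $\boldsymbol{B}_{\mathbb{Z}}^{\mathscr{F}}$ is defined as the Rees quotient $(\mathbb{Z}\times\mathbb{Z}\times\mathscr{F},\cdot)/\boldsymbol{I}$ ($\boldsymbol{I}$ is collapsed to one element, the zero); if $\varnothing\notin\mathscr{F}$, then $\boldsymbol{B}_{\mathbb{Z}}^{\mathscr{F}}=(\mathbb{Z}\times\mathbb{Z}\times\mathscr{F},\cdot)$.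 A semigroup $S$ is inverse if for each $x\in S$ there is a unique $x^{-1}\in S$ with $xx^{-1}x=x$ and $x^{-1}xx^{-1}=x^{-1}$. An inverse semigroup is combinatorial if its Green relation $\mathscr{H}$ is the equality relation. *)

(* Defs.v *)
From HB Require Import structures.
From mathcomp Require Import all_boot all_order all_algebra.
From mathcomp Require Import boolp classical_sets.
From mathcomp Require Import zify.
Set Implicit Arguments.
Unset Strict Implicit.
Unset Printing Implicit Defensive.
Import Order.TTheory GRing.Theory Num.Theory.
Local Open Scope classical_set_scope.
Local Open Scope quotient_scope.

Section Semigroups.
Local Open Scope group_scope.
Variable S : semigroupType.

Definition inverse_semigroup : Prop :=
  forall x : S, exists! y : S, x * y * x = x /\ y * x * y = y.

(* The principal one-sided ideals [S^1 a] and [a S^1]: adjoining an identity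
   to [S] amounts to adding [a] itself to [S a] and to [a S]. *)
Definition left_ideal1 (a : S) : set S := a |` [set s * a | s in [set: S]].
Definition right_ideal1 (a : S) : set S := a |` [set a * s | s in [set: S]].

Definition greenL (a b : S) : Prop := left_ideal1 a = left_ideal1 b.
Definition greenR (a b : S) : Prop := right_ideal1 a = right_ideal1 b.
Definition greenH (a b : S) : Prop := greenL a b /\ greenR a b.

Definition combinatorial : Prop := forall a b : S, greenH a b <-> a = b.

Definition is_ideal (I : set S) : Prop :=
  I !=set0 /\ forall a x : S, I x -> I (a * x) /\ I (x * a).

Definition rees_rel (I : set S) : rel S :=
  fun x y => (x == y) || ((x \in I) && (y \in I)).

Lemma rees_rel_refl I : reflexive (rees_rel I).
Proof. by move=> x; rewrite /rees_rel eqxx. Qed.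

Lemma rees_rel_sym I : symmetric (rees_rel I).
Proof. by move=> x y; rewrite /rees_rel eq_sym andbC. Qed.

Lemma rees_rel_trans I : transitive (rees_rel I).
Proof.
move=> y x z /orP[/eqP->//|/andP[xI yI]] /orP[/eqP<-|/andP[_ zI]];
by rewrite /rees_rel ?xI ?yI ?zI orbT.
Qed.

Canonical rees_equiv (I : set S) :=
  EquivRel (rees_rel I) (@rees_rel_refl I) (@rees_rel_sym I)
    (@rees_rel_trans I).

End Semigroups.

(* The Rees quotient [S / I], as the quotient by the congruence [rees_rel I];
   the proof that [I] is an ideal is kept in the type so that associativity of
   the induced multiplication can be attached to it. *)
Definition rees (S : semigroupType) (I : set S) of is_ideal I : Type :=
  {eq_quot rees_rel I}.

Section ReesQuotient.
Local Open Scope group_scope.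
Variables (S : semigroupType) (I : set S) (idI : is_ideal I).

HB.instance Definition _ := Choice.on (rees idI).
HB.instance Definition _ := EqQuotient.on (rees idI).

Definition rees_mul (x y : rees idI) : rees idI :=
  \pi_(rees idI) (repr x * repr y).

Lemma rees_mul_pi (x y : S) :
  rees_mul (\pi_(rees idI) x) (\pi_(rees idI) y) = \pi_(rees idI) (x * y).
Proof.
rewrite /rees_mul; apply/eqmodP => /=.
have /eqmodP/= := reprK (\pi_(rees idI) x).
have /eqmodP/= := reprK (\pi_(rees idI) y).
move: (repr _) (repr _) => x' y'; rewrite /rees_rel.
have mulI a b : (a \in I) || (b \in I) -> a * b \in I.
  by case/orP => /set_mem Iab; apply/mem_set;
    [have [] := idI.2 b a Iab | have [] := idI.2 a b Iab].
case/orP => [/eqP->|/andP[x'I yI]]; case/orP => [/eqP->|/andP[y'I xI]];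
  first by rewrite eqxx.
- by rewrite !mulI ?y'I ?xI ?orbT.
- by rewrite !mulI ?x'I ?yI ?orbT.
- by rewrite !mulI ?y'I ?xI ?orbT.
Qed.

Lemma rees_mulA : associative rees_mul.
Proof.
elim/quotW=> x; elim/quotW=> y; elim/quotW=> z.
by rewrite (rees_mul_pi y z) (rees_mul_pi x y)
  (rees_mul_pi x) (rees_mul_pi _ z) mulgA.
Qed.

HB.instance Definition _ := isSemigroup.Build (rees idI) rees_mulA.

End ReesQuotient.

Local Open Scope ring_scope.

(* Subsets of the non-negative integers are represented as subsets of [int]
   contained in [omega], so that translates by negative integers make sense. *)
Definition omega : set int := [set n | 0 <= n].

Definition translate (n : int) (A : set int) : set int := [set n + a | a in A].

Definition omega_closed (F : set (set int)) : Prop :=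
  forall (n : nat) (F1 F2 : set int), F F1 -> F F2 ->
    F (F1 `&` translate (- n%:Z) F2).

Definition triple_mul (x y : int * int * set int) : int * int * set int :=
  let: (i1, j1, F1) := x in
  let: (i2, j2, F2) := y in
  if j1 < i2 then (i1 - j1 + i2, j2, translate (j1 - i2) F1 `&` F2)
  else if j1 == i2 then (i1, j2, F1 `&` F2)
  else (i1, j1 - i2 + j2, F1 `&` translate (i2 - j1) F2).

Definition triples (F : set (set int)) : set (int * int * set int) :=
  [set: int] `*` [set: int] `*` F.

Lemma translateE (n : int) (A : set int) (z : int) :
  translate n A z = A (z - n).
Proof.
apply/propext; split=> [[a Aa <-]|Az]; first by rewrite addrC addKr.
by exists (z - n) => //; rewrite addrC subrK.
Qed.

Lemma translate0 (A : set int) : translate 0 A = A.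
Proof. by apply/funext => z; rewrite translateE subr0. Qed.

Lemma triple_mul_closed (F : set (set int)) (x y : int * int * set int) :
  omega_closed F -> triples F x -> triples F y -> triples F (triple_mul x y).
Proof.
case: x y => [[i1 j1] F1] [[i2 j2] F2] clF [_ /= FF1] [_ /= FF2].
split=> //=; case: ifP => [lt12|le21] /=.
  have -> : j1 - i2 = - `|i2 - j1|%N%:Z by lia.
  by rewrite setIC; apply: clF.
case: ifP => [_|ne12] /=.
  by rewrite -[F2]translate0 -oppr0; apply: (clF 0%N).
have -> : i2 - j1 = - `|i2 - j1|%N%:Z by lia.
exact: clF.
Qed.

Lemma triple_mulA : associative triple_mul.
Proof.
move=> [[i1 j1] F1] [[i2 j2] F2] [[i3 j3] F3].
have key (i i' j j' : int) (A A' : set int) : i = i' -> j = j' ->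
  (forall z, A z = A' z) -> (i, j, A) = (i', j', A').
  by move=> -> -> /funext->.
have setIE (A B : set int) z : (A `&` B) z = (A z /\ B z) by [].
rewrite /triple_mul; do !case: ifP => ? //=; try lia;
  apply: key; try lia; move=> z; rewrite !(setIE, translateE) ?andA;
  congr (and (and (F1 _) (F2 _)) (F3 _)); lia.
Qed.

(* The semigroup of triples; the proof of omega-closedness is kept in the type
   since it is what makes the multiplication internal. *)
Definition triple_semigroup (F : set (set int)) of omega_closed F : Type :=
  set_type (triples F).

Section TripleSemigroup.
Variables (F : set (set int)) (clF : omega_closed F).

HB.instance Definition _ := SubChoice.on (triple_semigroup clF).

Definition bz_mul (x y : triple_semigroup clF) : triple_semigroup clF :=
  SigSub (mem_set (triple_mul_closed clF (set_mem (valP x)) (set_mem (valP y)))).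

Lemma bz_mulA : associative bz_mul.
Proof. by move=> x y z; apply: val_inj; rewrite /= triple_mulA. Qed.

HB.instance Definition _ := isSemigroup.Build (triple_semigroup clF) bz_mulA.

Definition empty_ideal : set (triple_semigroup clF) :=
  [set x | (val x).2 = set0].

Lemma empty_ideal_is_ideal : F set0 -> is_ideal empty_ideal.
Proof.
move=> F0; split.
  have F00 : triples F (0, 0, set0) by [].
  by exists (SigSub (mem_set F00)).
have translate_set0 n : translate n set0 = set0 by exact: image_set0.
move=> [[[i1 j1] F1] h1] [[[i2 j2] F2] h2]; rewrite /empty_ideal /= => ->.
by split; do !case: ifP => _ //=; rewrite ?translate_set0 ?setI0 ?set0I.
Qed.

Definition BZ : semigroupType :=
  match pselect (F set0) with
  | left F0 => rees (empty_ideal_is_ideal F0)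
  | right _ => triple_semigroup clF
  end.

End TripleSemigroup.

(* Main.v *)
(** The inverse of [(i, j, A)] is [(j, i, A)]. In a product [s * b] the second
index is at least that of [b], with equality only if its set is contained in
that of [b]; so L-equivalent triples share their second index and their set, and
dually R-equivalent triples share their first index. The same inequalities,
applied to [x * y * x = x] and [y * x * y = y], determine the indices of [y].
Outside the ideal [I], an equation in the Rees quotient [S / I] is an equation
in [S], while the elements of [I] become a zero, so both properties pass from
[S] to [S / I]. *)
Require Import Defs.
From mathcomp Require Import all_boot all_order all_algebra.
From mathcomp Require Import boolp classical_sets.
From mathcomp Require Import zify.
Import Order.TTheory GRing.Theory Num.Theory.
Local Open Scope classical_set_scope.

(** * Green's relations through mutual membership in principal one-sided ideals *)

Section Ideals.
Local Set Implicit Arguments.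
Local Unset Strict Implicit.
Local Open Scope group_scope.
Variable S : semigroupType.

Lemma left_ideal1_refl (a : S) : left_ideal1 a a. Proof. by left. Qed.

Lemma right_ideal1_refl (a : S) : right_ideal1 a a. Proof. by left. Qed.

(** By associativity [left_ideal1 d] absorbs left multiplication, so it contains the principal left
    ideal of each of its elements. *)
Lemma greenLP (a b : S) :
  greenL a b <-> left_ideal1 b a /\ left_ideal1 a b.
Proof.
split=> [Lab|[ba ab]].
  by split; [rewrite -Lab | rewrite Lab]; exact: left_ideal1_refl.
have sub (c d : S) : left_ideal1 d c -> left_ideal1 c `<=` left_ideal1 d.
  move=> dc x [->//|[s _ <-]]; right.
  by case: dc => [->|[t _ <-]]; [exists s | exists (s * t); rewrite ?mulgA].
by apply/seteqP; split; apply: sub.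
Qed.

Lemma greenRP (a b : S) :
  greenR a b <-> right_ideal1 b a /\ right_ideal1 a b.
Proof.
split=> [Rab|[ba ab]].
  by split; [rewrite -Rab | rewrite Rab]; exact: right_ideal1_refl.
have sub (c d : S) : right_ideal1 d c -> right_ideal1 c `<=` right_ideal1 d.
  move=> dc x [->//|[s _ <-]]; right.
  by case: dc => [->|[t _ <-]]; [exists s | exists (t * s); rewrite ?mulgA].
by apply/seteqP; split; apply: sub.
Qed.

End Ideals.

(** * Transfer of both properties to a Rees quotient *)

Section ReesQuotient.
Local Set Implicit Arguments.
Local Unset Strict Implicit.
Local Open Scope group_scope.
Local Open Scope quotient_scope.
Variables (S : semigroupType) (I : set S) (idI : is_ideal I).
Local Notation pi := (\pi_(rees idI)).

Lemma rees_pi_mul (x y : S) : pi x * pi y = pi (x * y).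
Proof. exact: rees_mul_pi. Qed.

(* Arguments are given explicitly since unification may unfold a product in the
quotient into the projection of a product of representatives. *)
Lemma rees_pi_mul3 (x y z : S) : pi x * pi y * pi z = pi (x * y * z).
Proof. by rewrite (rees_pi_mul x y) (rees_pi_mul (x * y) z). Qed.

Lemma rees_pi_eq (x y : S) : pi x = pi y <-> x = y \/ I x /\ I y.
Proof.
split=> [/eqmodP/orP[/eqP|/andP[/set_mem Ix /set_mem Iy]]|]; [by left|by right|].
by case=> [->//|[Ix Iy]]; apply/eqmodP/orP; right; rewrite !mem_set.
Qed.

Lemma rees_pi_eqNl (x y : S) : ~ I x -> pi x = pi y -> x = y.
Proof. by move=> NIx /rees_pi_eq[//|[]]. Qed.

Lemma ideal_mull (x y : S) : I y -> I (x * y).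
Proof. by case/(idI.2 x). Qed.

Lemma ideal_mulr (x y : S) : I x -> I (x * y).
Proof. by case/(idI.2 y). Qed.

Lemma rees_pi_eqI (x y : S) : pi x = pi y -> I y -> I x.
Proof. by move=> /rees_pi_eq[->|[]]. Qed.

Lemma rees_inverse_semigroup : inverse_semigroup S -> inverse_semigroup (rees idI).
Proof.
move=> invS; elim/quotW=> x; have [y [[xyx yxy] y_uniq]] := invS x.
exists (pi y); split; first by rewrite !rees_pi_mul3 xyx yxy.
elim/quotW=> z; rewrite !rees_pi_mul3 => -[xzx zxz].
have [Ix|NIx] := pselect (I x).
  (* Here [y = y * x * y] and, modulo [I], [z = z * x * z] have a factor in [I], so both represent
     the zero. *)
  apply/rees_pi_eq; right; split.
    by rewrite -yxy; apply/ideal_mulr/ideal_mull.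
  by apply: (rees_pi_eqI (esym zxz)); apply/ideal_mulr/ideal_mull.
have {}xzx := rees_pi_eqNl NIx (esym xzx).
have NIz : ~ I z by move=> Iz; apply: NIx; rewrite xzx; apply/ideal_mulr/ideal_mull.
have {}zxz := rees_pi_eqNl NIz (esym zxz).
by rewrite (y_uniq z).
Qed.

Lemma rees_left_ideal1 (a b : S) : ~ I a ->
  left_ideal1 (pi b) (pi a) -> left_ideal1 b a.
Proof.
move=> NIa [/(rees_pi_eqNl NIa)->|[s _]]; first by left.
elim/quotW: s => s; rewrite rees_pi_mul => /esym/(rees_pi_eqNl NIa)->.
by right; exists s.
Qed.

Lemma rees_right_ideal1 (a b : S) : ~ I a ->
  right_ideal1 (pi b) (pi a) -> right_ideal1 b a.
Proof.
move=> NIa [/(rees_pi_eqNl NIa)->|[s _]]; first by left.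
elim/quotW: s => s; rewrite rees_pi_mul => /esym/(rees_pi_eqNl NIa)->.
by right; exists s.
Qed.

(** The zero has only itself as a left multiple, hence it forms an L-class of its own. *)
Lemma rees_left_ideal1_zero (a b : S) : I b -> left_ideal1 (pi b) (pi a) -> I a.
Proof.
move=> Ib [/rees_pi_eqI|[s _]]; first exact.
elim/quotW: s => s; rewrite rees_pi_mul => /esym/rees_pi_eqI; apply.
exact: ideal_mull.
Qed.

Lemma rees_combinatorial : combinatorial S -> combinatorial (rees idI).
Proof.
move=> combS; elim/quotW=> a; elim/quotW=> b; split=> [|->//].
case=> /greenLP[Lba Lab] /greenRP[Rba Rab].
have [Ia|NIa] := pselect (I a).
  by apply/rees_pi_eq; right; split=> //; apply: rees_left_ideal1_zero Lab.
have NIb : ~ I b by move=> Ib; apply: NIa; apply: rees_left_ideal1_zero Lba.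
congr (\pi_(_)%qT _); apply/combS; split.
  by apply/greenLP; split; apply: rees_left_ideal1; eassumption.
by apply/greenRP; split; apply: rees_right_ideal1; eassumption.
Qed.

End ReesQuotient.

(** * Inverses and Green's relations for triples *)

Section Triples.
Local Set Implicit Arguments.
Local Unset Strict Implicit.
Local Open Scope ring_scope.
Implicit Types (i j : int) (A : set int) (x y : int * int * set int).

Definition triple_inv x := (x.1.2, x.1.1, x.2).

Lemma triple_invK : involutive triple_inv. Proof. by case=> [[]]. Qed.

Lemma triple_mulKV x : triple_mul (triple_mul x (triple_inv x)) x = x.
Proof. by case: x => [[i j] A]; do 2!rewrite /= ltxx eqxx; rewrite !setIid. Qed.

(** For [x = (i, j, A)] and [y = (k, l, B)] the first index of the product is [i + max(0, k - j)];
    dually, the second is [l + max(0, j - k)]. *)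
Lemma triple_mul_leif1 x y :
  x.1.1 <= (triple_mul x y).1.1 ?= iff (y.1.1 <= x.1.2).
Proof.
case: x y => [[i j] A] [[k l] B] /=; apply/leifP.
by do !case: ifP => //=; lia.
Qed.

Lemma triple_mul_leif2 x y :
  y.1.2 <= (triple_mul x y).1.2 ?= iff (x.1.2 <= y.1.1).
Proof.
case: x y => [[i j] A] [[k l] B] /=; apply/leifP.
by do !case: ifP => //=; lia.
Qed.

Lemma triple_mul_sub2 x y : x.1.2 <= y.1.1 -> (triple_mul x y).2 `<=` y.2.
Proof.
case: x y => [[i j] A] [[k l] B] /= jk; case: ifP => [_ ? []//|?].
by rewrite ifT; [move=> ? [] | lia].
Qed.

(** The first index cannot decrease from [x] to [x * y] to [x * y * x = x], so it is constant and
    the equality case applies; the second index is treated alike through [y * x]. *)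
Lemma triple_mul_regular_le x y : triple_mul (triple_mul x y) x = x ->
  y.1.1 <= x.1.2 /\ y.1.2 <= x.1.1.
Proof.
move=> xyx; split.
  rewrite -(triple_mul_leif1 x y).2 eq_le (triple_mul_leif1 x y).1 /=.
  by rewrite -[in leRHS]xyx (triple_mul_leif1 _ x).1.
rewrite -(triple_mul_leif2 y x).2 eq_le (triple_mul_leif2 y x).1 /=.
by rewrite -[in leRHS]xyx -triple_mulA (triple_mul_leif2 x _).1.
Qed.

Lemma triple_mul_inv_uniq x y :
  triple_mul (triple_mul x y) x = x -> triple_mul (triple_mul y x) y = y ->
  y = triple_inv x.
Proof.
move=> xyx yxy; have [yx1 yx2] := triple_mul_regular_le xyx.
have [xy1 xy2] := triple_mul_regular_le yxy.
have /eqP : y.1.1 == x.1.2 by rewrite eq_le yx1.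
have /eqP : y.1.2 == x.1.1 by rewrite eq_le yx2.
move: xyx yxy {yx1 yx2 xy1 xy2}; case: x y => [[i j] A] [[k l] B].
rewrite /triple_inv => + + /= l_i k_j; rewrite {}l_i {}k_j.
do !rewrite /= ?ltxx ?eqxx.
(* With matching indices nothing is translated: each of [A] and [B] equals its intersection with the
   other. *)
move=> [AB] [BA]; congr (_, _, _); move: AB BA.
rewrite setIAC setIid => AB; rewrite setIAC setIid setIC => BA.
by rewrite -[RHS]AB BA.
Qed.

Variables (F : set (set int)) (clF : omega_closed F).

Lemma triples_inv x : triples F x -> triples F (triple_inv x).
Proof. by case: x => [[i j] A] []. Qed.

Lemma triple_inverse_semigroup : inverse_semigroup (triple_semigroup clF).
Proof.
move=> x; exists (SigSub (mem_set (triples_inv (set_mem (valP x))))).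
split=> [|y [xyx yxy]].
  split; apply: val_inj; first exact: triple_mulKV.
  (* The second identity is the first one for the inverse triple. *)
  by have := triple_mulKV (triple_inv (val x)); rewrite triple_invK.
apply: val_inj; apply/esym.
exact: (triple_mul_inv_uniq (congr1 val xyx) (congr1 val yxy)).
Qed.

(** When the second index grows strictly, the set of [b] gets translated, so the inclusion is
    restricted to equal indices. *)
Lemma triple_left_ideal1 (a b : triple_semigroup clF) : left_ideal1 b a ->
  (val b).1.2 <= (val a).1.2 /\
  ((val a).1.2 = (val b).1.2 -> (val a).2 `<=` (val b).2).
Proof.
case=> [->|[s _ <-]]; first by split=> [|_]; [exact: lexx | exact: subset_refl].
have [le2 eq2] := triple_mul_leif2 (val s) (val b).
by split=> // /esym/eqP; rewrite eq2; exact: triple_mul_sub2.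
Qed.

Lemma triple_right_ideal1 (a b : triple_semigroup clF) : right_ideal1 b a ->
  (val b).1.1 <= (val a).1.1.
Proof. by case=> [->|[s _ <-]]; [exact: lexx | exact: (triple_mul_leif1 _ _).1]. Qed.

Lemma triple_combinatorial : combinatorial (triple_semigroup clF).
Proof.
move=> a b; split=> [|->//] [/greenLP[]].
move=> /triple_left_ideal1[ba subab] /triple_left_ideal1[ab subba].
move=> /greenRP[/triple_right_ideal1 ba1 /triple_right_ideal1 ab1].
have e1 : (val a).1.1 = (val b).1.1 by apply/le_anti/andP.
have e2 : (val a).1.2 = (val b).1.2 by apply/le_anti/andP.
have e3 : (val a).2 = (val b).2 by apply/seteqP; split; [exact: subab | exact: subba].
apply: val_inj; move: e1 e2 e3.
by case: (val a) (val b) => [[? ?] ?] [[? ?] ?] /= -> -> ->.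
Qed.

End Triples.

Theorem mainTheorem2 (F : set (set int)) (Fomega : F `<=` [set A | A `<=` omega])
    (clF : omega_closed F) :
  inverse_semigroup (BZ clF) /\ combinatorial (BZ clF).
Proof.
rewrite /BZ; case: pselect => [F0|_]; split.
- exact/rees_inverse_semigroup/triple_inverse_semigroup.
- exact/rees_combinatorial/triple_combinatorial.
- exact: triple_inverse_semigroup.
- exact: triple_combinatorial.
Qed.
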